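(* Let $L$ be a (right) Leibniz algebra over a field with product $\langle -,-\rangle$, and let $T\subseteq L$ be a subspace closed under the trilinear operation $\langle a,b,c\rangle=\langle\langle a,b\rangle,c\rangle$. Then $T$ with this trilinear operation is a Leibniz triple system.
   Context: A (right) Leibniz algebra is a vector space $L$ with a bilinear map $(a,b)\mapsto\langle a,b\rangle$ satisfying $\langle\langle a,b\rangle,c\rangle=\langle\langle a,c\rangle,b\rangle+\langle a,\langle b,c\rangle\rangle$ for all $a,b,c\in L$. A Leibniz triple system is a vector space $T$ with a trilinear operation $\langle -,-,-\rangle\colon T\times T\times T\to T$ satisfying, for all $a,b,c,d,e\in T$, $$\langle a,\langle b,c,d\rangle,e\rangle=\langle\langle a,b,c\rangle,d,e\rangle-\langle\langle a,c,b\rangle,d,e\rangle-\langle\langle a,d,b\rangle,c,e\rangle+\langle\langle a,d,c\rangle,b,e\rangle,$$ $$\langle a,b,\langle c,d,e\rangle\rangle=\langle\langle a,b,c\rangle,d,e\rangle-\langle\langle a,b,d\rangle,c,e\rangle-\langle\langle a,b,e\rangle,c,d\rangle+\langle\langle a,b,e\rangle,d,c\rangle.$$ *)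

(* Defs.v *)
(* Subspaces are taken in [set L], so membership need not be decidable. *)
From HB Require Import structures.
From mathcomp Require Import all_boot all_order all_algebra.
From mathcomp Require Import boolp classical_sets.

Set Implicit Arguments.
Unset Strict Implicit.
Unset Printing Implicit Defensive.

Import GRing.Theory.
Local Open Scope ring_scope.

Definition bilinear_map (K : fieldType) (U V W : lmodType K)
    (f : U -> V -> W) : Prop :=
  (forall v, linear (fun u => f u v)) /\ (forall u, linear (fun v => f u v)).

Definition trilinear_map (K : fieldType) (U V W X : lmodType K)
    (f : U -> V -> W -> X) : Prop :=
  [/\ forall v w, linear (fun u => f u v w),
      forall u w, linear (fun v => f u v w)
    & forall u v, linear (fun w => f u v w)].

Definition right_leibniz_algebra (K : fieldType) (L : lmodType K)
    (br : L -> L -> L) : Prop :=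
  bilinear_map br /\
  forall a b c, br (br a b) c = br (br a c) b + br a (br b c).

Definition leibniz_triple_system (K : fieldType) (T : lmodType K)
    (t : T -> T -> T -> T) : Prop :=
  [/\ trilinear_map t,
      forall a b c d e,
        t a (t b c d) e = t (t a b c) d e - t (t a c b) d e
                          - t (t a d b) c e + t (t a d c) b e
    & forall a b c d e,
        t a b (t c d e) = t (t a b c) d e - t (t a b d) c e
                          - t (t a b e) c d + t (t a b e) d c].

Section Subspace.
Variables (K : fieldType) (L : lmodType K) (T : set L).

(* The proof argument is not used in the body: it keys the vector space       *)
(* structure inherited from L.                                                *)
Definition subspace (subT : submod_closed (mem T)) : Type := {x : L | x \in T}.

Variable subT : submod_closed (mem T).

HB.instance Definition _ := SubType.on (subspace subT).
HB.instance Definition _ := [Choice of subspace subT by <:].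
HB.instance Definition _ :=
  GRing.SubChoice_isSubLmodule.Build K L (mem T) (subspace subT)
    (GRing.submod_closed_semi subT).

Definition triple (br : L -> L -> L) (a b c : L) : L := br (br a b) c.

Definition triple_closed (br : L -> L -> L) : Prop :=
  forall a b c, a \in T -> b \in T -> c \in T -> triple br a b c \in T.

Definition subspace_triple (br : L -> L -> L) (clT : triple_closed br)
    (a b c : subspace subT) : subspace subT :=
  exist _ (triple br (val a) (val b) (val c))
    (clT _ _ _ (valP a) (valP b) (valP c)).

End Subspace.

Arguments subspace_triple {K L T} subT {br} clT a b c.

(* Main.v *)
(* Right multiplication by [c] is a derivation, equivalently                  *)
(* <x,<b,c>> = <<x,b>,c> - <<x,c>,b>. Applying this twice rewrites            *)
(* <x,<<b,c>,d>> as a combination of left-normed products: x = <a,b> gives    *)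
(* one triple identity, and bracketing with e on the right gives the other.   *)
Require Import Defs.
From mathcomp Require Import all_boot all_order all_algebra.
From mathcomp Require Import boolp classical_sets.

Import GRing.Theory.

Section RightLeibniz.
Local Open Scope ring_scope.
Context {K : fieldType} {L : lmodType K} {br : L -> L -> L}.
Hypothesis brP : right_leibniz_algebra br.

(** Both triple identities already hold in [L] and pass to the subspace because [val] is additive
    and injective. They are instances of [leibniz_br_triple], at x = a and at x = <a,b>. *)

Lemma leibniz_brPl y k a b : br (k *: a + b) y = k *: br a y + br b y.
Proof. by case: brP => -[brl _] _; apply: brl. Qed.

Lemma leibniz_brPr x k a b : br x (k *: a + b) = k *: br x a + br x b.
Proof. by case: brP => -[_ brr] _; apply: brr. Qed.

Lemma leibniz_brDl a b y : br (a + b) y = br a y + br b y.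
Proof. by rewrite -[a]scale1r leibniz_brPl !scale1r. Qed.

Lemma leibniz_brBl a b y : br (a - b) y = br a y - br b y.
Proof. by rewrite addrC -scaleN1r leibniz_brPl scaleN1r addrC. Qed.

Lemma leibniz_br_br a b c : br a (br b c) = br (br a b) c - br (br a c) b.
Proof. by case: brP => _ ->; rewrite addrC addKr. Qed.

Lemma leibniz_br_triple x b c d :
  br x (triple br b c d) = triple br (br x b) c d - triple br (br x c) b d
                           - triple br (br x d) b c + triple br (br x d) c b.
Proof.
(* Split off d with <b,c> kept as one block, then expand <b,c> in both resulting terms. *)
rewrite /triple (leibniz_br_br x (br b c) d) !(leibniz_br_br _ b c).
by rewrite leibniz_brBl opprB addrA addrAC.
Qed.

End RightLeibniz.

Theorem proposition17 (K : fieldType) (L : lmodType K) (br : L -> L -> L)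
    (brP : right_leibniz_algebra br)
    (T : set L) (subT : GRing.submod_closed (mem T)) (clT : triple_closed T br) :
  leibniz_triple_system (subspace_triple subT clT).
Proof.
split; first split.
- move=> v w k a b; apply: val_inj.
  by rewrite linearP /= /triple !(leibniz_brPl brP).
- move=> u w k a b; apply: val_inj.
  by rewrite linearP /= /triple (leibniz_brPr brP) (leibniz_brPl brP).
- move=> u v k a b; apply: val_inj.
  by rewrite linearP /= /triple (leibniz_brPr brP).
- move=> a b c d e; apply: val_inj.
  (* Only the outermost [triple] is unfolded, exposing <a,<b,c,d>> inside the bracket with e. *)
  rewrite !(raddfD, raddfN) /= {1}/triple (leibniz_br_triple brP).
  by rewrite (leibniz_brDl brP) !(leibniz_brBl brP).
- move=> a b c d e; apply: val_inj.
  (* With x = <a,b>, the two sides agree up to unfolding [triple]. *)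
  by rewrite !(raddfD, raddfN) /= {1}/triple (leibniz_br_triple brP).
Qed.
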